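(* Let $0\le k\le n$ and let $\mathsf{N}_1,\dots,\mathsf{N}_s$ be a set of representatives of the isomorphism classes of graphic Schubert matroids of rank $k$ on $n$ elements. Then for every matroid $\mathsf{M}$ of rank $k$ on $n$ elements there exist unique integers $c_1,\dots,c_s$ such that $T_{\mathsf{M}}(x,y)=\sum_{i=1}^s c_i\,T_{\mathsf{N}_i}(x,y)$.
   Context: $T_{\mathsf{M}}(x,y)$ is the Tutte polynomial. A matroid is Schubert (nested) if its lattice of cyclic flats is a chain. *)

(* Defs.v *)
From HB Require Import structures.
From mathcomp Require Import all_boot all_order all_algebra.
From mathcomp Require Import fingroup perm.
Set Implicit Arguments. Unset Strict Implicit. Unset Printing Implicit Defensive.
Import GRing.Theory.

Record matroid (T : finType) := Matroid {
  mrank : {set T} -> nat;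
  mrank_card : forall A : {set T}, mrank A <= #|A|;
  mrank_mono : forall A B : {set T}, A \subset B -> mrank A <= mrank B;
  mrank_submod : forall A B : {set T}, mrank (A :|: B) + mrank (A :&: B) <= mrank A + mrank B
}.

Definition mat_rank (T : finType) (M : matroid T) : nat := mrank M setT.

Definition dependent (T : finType) (M : matroid T) (A : {set T}) : bool :=
  mrank M A < #|A|.
Definition circuit (T : finType) (M : matroid T) (C : {set T}) : Prop :=
  dependent M C /\ forall D : {set T}, D \proper C -> ~~ dependent M D.

Definition flat (T : finType) (M : matroid T) (F : {set T}) : Prop :=
  forall e, e \notin F -> mrank M F < mrank M (e |: F).
Definition cyclic (T : finType) (M : matroid T) (F : {set T}) : Prop :=
  forall e, e \in F -> exists C : {set T}, [/\ circuit M C, e \in C & C \subset F].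
Definition cyclic_flat (T : finType) (M : matroid T) (F : {set T}) : Prop :=
  flat M F /\ cyclic M F.

Definition schubert (T : finType) (M : matroid T) : Prop :=
  forall F G, cyclic_flat M F -> cyclic_flat M G -> F \subset G \/ G \subset F.

(* Graphs (multigraphs, loops allowed) with vertex set 'I_m and edge set T;
   ends e gives the two endpoints of edge e. *)
Definition gadj (T : finType) (m : nat) (ends : T -> 'I_m * 'I_m) (A : {set T})
  : rel 'I_m :=
  fun u v => [exists e in A, (ends e == (u, v)) || (ends e == (v, u))].

Definition ncomp (T : finType) (m : nat) (ends : T -> 'I_m * 'I_m) (A : {set T})
  : nat :=
  #|[set [set w | connect (gadj ends A) v w] | v : 'I_m]|.

Definition graph_rank (T : finType) (m : nat) (ends : T -> 'I_m * 'I_m)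
  (A : {set T}) : nat := m - ncomp ends A.

Definition graphic (T : finType) (M : matroid T) : Prop :=
  exists m (ends : T -> 'I_m * 'I_m), forall A : {set T}, mrank M A = graph_rank ends A.

Definition mat_iso (T : finType) (M N : matroid T) : Prop :=
  exists f : {perm T}, forall A : {set T}, mrank N (f @: A) = mrank M A.

(* Tutte polynomial as an element of Z[x][y]... encoded as {poly {poly int}}:
   the outer variable 'X is x, the inner variable ('X%:P) is y. *)
Local Open Scope ring_scope.
Definition tutte (T : finType) (M : matroid T) : {poly {poly int}} :=
  \sum_(A : {set T})
     ('X - 1) ^+ (mrank M setT - mrank M A) *
     (('X - 1)%:P) ^+ (#|A| - mrank M A).

(* Main.v *)
Require Import Defs.
From HB Require Import structures.
From mathcomp Require Import all_boot all_order all_algebra.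
From mathcomp Require Import fingroup perm.
From mathcomp Require Import zify ring.
Set Implicit Arguments. Unset Strict Implicit. Unset Printing Implicit Defensive.
Import GRing.Theory.

(* A graphic Schubert matroid is a direct sum of l loops, a coloops and a cycle
   one edge of which has been thickened to a parallel class: a circuit C of
   maximal rank spans the part without loops and coloops, a chord e would split
   C into two paths whose closures are incomparable unless one of them is a
   single edge, and the closures of two parallel classes are incomparable as
   well.  With d = n - k its Tutte polynomial is
     x^k y^d - D (y^l + ... + y^(d-1)) (x^a + ... + x^(k-1)),  D = xy - x - y,
   with l < d and a < k, or l = d and a = k.  The products of the two sums form
   a triangular basis of the integer polynomials of bidegree < (k, d).  For an
   arbitrary M of rank k the difference T_M - x^k y^d is D times such a
   polynomial: D = XY - 1 for X = x - 1, Y = y - 1, and each subset contributes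
   to T_M a monomial X^i Y^j in which i - j only depends on its size. *)

(** * Closure and circuits *)

Lemma set_ind_add (T : finType) (P : {set T} -> Prop) :
  P set0 -> (forall e (A : {set T}), e \notin A -> P A -> P (e |: A)) -> forall A, P A.
Proof.
move=> P0 PU A; have [m] := ubnP #|A|; elim: m A => // m IH A lt_Am.
have [->//|[e eA]] := set_0Vmem A.
rewrite -(setD1K eA); apply: PU; first by rewrite !inE eqxx.
by apply: IH; move: lt_Am; rewrite (cardsD1 e A) eA.
Qed.

Section MatroidTheory.
Context (T : finType) (M : matroid T).
Local Notation r := (mrank M).
Implicit Types (A B C D K X Y : {set T}) (e f c : T).

Definition mclosure A : {set T} := [set e | r (e |: A) == r A].

Lemma mclosureP e A : reflect (r (e |: A) = r A) (e \in mclosure A).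
Proof. by rewrite inE; apply: eqP. Qed.

Lemma mrank0 : r set0 = 0.
Proof. by apply/eqP; rewrite -leqn0 -(cards0 T) mrank_card. Qed.

Lemma mrank_setU1 e A : r (e |: A) <= (r A).+1.
Proof.
have := mrank_submod M [set e] A; have := mrank_card M [set e].
by rewrite cards1; lia.
Qed.

Lemma mrank_notin_closure e A : e \notin mclosure A -> r (e |: A) = (r A).+1.
Proof.
rewrite inE => neq; have := mrank_setU1 e A.
by have := mrank_mono M (subsetUr [set e] A); move/eqP: neq; lia.
Qed.

Lemma sub_mclosure A : A \subset mclosure A.
Proof.
by apply/subsetP=> e eA; apply/mclosureP; rewrite (setUidPr _) // sub1set.
Qed.

Lemma mclosureS A B : A \subset B -> mclosure A \subset mclosure B.
Proof.
move=> sAB; apply/subsetP=> e /mclosureP eA; apply/mclosureP.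
have := mrank_submod M (e |: A) B.
have := mrank_mono M (subsetUr [set e] B).
have -> : e |: A :|: B = e |: B by rewrite -setUA (setUidPr sAB).
have : r A <= r ((e |: A) :&: B).
  by apply: mrank_mono; rewrite subsetI sAB subsetUr.
by lia.
Qed.

Lemma mrank_closureU A X : X \subset mclosure A -> r (A :|: X) = r A.
Proof.
elim/set_ind_add: X => [|e X _ IH]; first by rewrite setU0.
rewrite subUset sub1set => /andP[eA /IH <-].
rewrite setUCA; apply/mclosureP; exact: (subsetP (mclosureS (subsetUl _ _))).
Qed.

Lemma mrank_mclosure A : r (mclosure A) = r A.
Proof. by rewrite -[RHS](mrank_closureU (subxx _)) (setUidPr (sub_mclosure A)). Qed.

Lemma mclosure_sub A B : A \subset mclosure B -> mclosure A \subset mclosure B.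
Proof.
move=> sAB; apply/subsetP=> e /(subsetP (mclosureS sAB))/mclosureP.
rewrite mrank_mclosure => eB; apply/mclosureP/eqP.
rewrite eqn_leq [X in _ && X]mrank_mono ?subsetUr // -[X in _ <= X]eB.
by rewrite andbT mrank_mono // setUS // sub_mclosure.
Qed.

Lemma mclosure_flat A : flat M (mclosure A).
Proof.
move=> e eA; rewrite mrank_notin_closure //.
by apply: contra eA; apply: subsetP; apply: mclosure_sub.
Qed.

Lemma indepP A :
  (forall e, e \in A -> e \notin mclosure (A :\ e)) -> r A = #|A|.
Proof.
elim/set_ind_add: A => [|e A eA IH] indA; first by rewrite mrank0 cards0.
rewrite mrank_notin_closure ?cardsU1 ?eA ?IH // => [f fA|].
  have fe : f != e by apply: contraNneq eA => <-.
  apply: contra (indA f _); last by rewrite !inE fA orbT.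
  by apply/subsetP/mclosureS/setSD/subsetUr.
by have := indA e; rewrite setU11 setU1K // => /(_ isT).
Qed.

Lemma indep_sub A B : A \subset B -> r B = #|B| -> r A = #|A|.
Proof.
move=> sAB rB; have := mrank_submod M A (B :\: A).
have := mrank_card M A; have := mrank_card M (B :\: A).
have -> : A :|: B :\: A = B by rewrite setDE setUIr setUCr setIT (setUidPr sAB).
have := cardsID A B; rewrite (setIidPr sAB) rB; lia.
Qed.

Lemma circuit_indep C A : circuit M C -> A \proper C -> r A = #|A|.
Proof.
case=> _ minC /minC; rewrite /dependent -leqNgt => leA.
by apply/eqP; rewrite eqn_leq leA mrank_card.
Qed.

Lemma circuit_dep C A : circuit M C -> A \subset C -> r A < #|A| -> A = C.
Proof.
move=> cC sAC rA; apply/eqP; have [|] := boolP (A == C) => // neq.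
have /(circuit_indep cC) : A \proper C by rewrite properEneq neq.
by lia.
Qed.

Lemma circuit_rank C : circuit M C -> (r C).+1 = #|C|.
Proof.
move=> cC; have [dC _] := cC; rewrite /dependent in dC.
have [E|[e eC]] := set_0Vmem C; first by move: dC; rewrite E cards0.
have /(circuit_indep cC) : C :\ e \proper C by apply: properD1.
have := mrank_mono M (subD1set C e); rewrite (cardsD1 e) eC in dC *; lia.
Qed.

Lemma circuit_closure C e : circuit M C -> e \in C -> e \in mclosure (C :\ e).
Proof.
move=> cC eC; apply/mclosureP; rewrite setD1K //.
have := circuit_rank cC; rewrite (cardsD1 e) eC.
by rewrite (circuit_indep cC (properD1 eC)); lia.
Qed.

(** A minimal [Y] inside [X] that spans [e] is independent, since an element spanned by the rest of
    [Y] could be dropped. By the same minimality [e |: Y] is a circuit. *)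
Lemma closure_circuit e X : e \notin X -> e \in mclosure X ->
  exists C, [/\ circuit M C, e \in C & C \subset e |: X].
Proof.
move=> eX eclX.
have [Y /minsetP[eclY minY] sYX] := @minset_exists _ (fun Y => e \in mclosure Y) X eclX.
have eY : e \notin Y by apply: contra eX; apply: (subsetP sYX).
have indY : r Y = #|Y|.
  apply: indepP => y yY; apply/negP => yclY.
  have: e \in mclosure (Y :\ y).
    apply: (subsetP (mclosure_sub _) e eclY).
    by rewrite -{1}(setD1K yY) subUset sub1set yclY sub_mclosure.
  move/minY/(_ (subD1set _ _))/setP/(_ y); by rewrite !inE eqxx yY.
exists (e |: Y); split; [split|by rewrite setU11|by rewrite setUS].
  by rewrite /dependent (mclosureP _ _ eclY) indY cardsU1 eY.
move=> D; rewrite properEneq => /andP[neqD sD]; rewrite /dependent -leqNgt.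
have sDY : D :\ e \subset Y.
  apply/subsetP=> f; rewrite !inE => /andP[fe fD].
  by move: (subsetP sD f fD); rewrite !inE (negPf fe).
have rD := indep_sub sDY indY.
have [eD|eD] := boolP (e \in D); last first.
  by rewrite -(_ : D :\ e = D) ?rD //; apply/setDidPl; rewrite disjoint_sym disjoints1.
rewrite -(setD1K eD) mrank_notin_closure ?cardsU1 ?rD ?setD11 //.
apply/negP=> /minY/(_ sDY) E; move/eqP: neqD; apply.
by rewrite -E setD1K.
Qed.

Lemma cyclic_mclosure A : cyclic M A -> cyclic_flat M (mclosure A).
Proof.
move=> cycA; split; first exact: mclosure_flat.
move=> e eclA; have [eA|eA] := boolP (e \in A).
  have [C [cC eC sCA]] := cycA e eA; exists C; split => //.
  exact: subset_trans sCA (sub_mclosure A).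
have [C [cC eC sCA]] := closure_circuit eA eclA; exists C; split => //.
by apply: (subset_trans sCA); rewrite subUset sub1set eclA sub_mclosure.
Qed.

(** The form in which the Schubert hypothesis is used: closures of circuits are cyclic flats, hence
    comparable. *)
Lemma schubert_circuits C K : schubert M -> circuit M C -> circuit M K ->
  C \subset mclosure K \/ K \subset mclosure C.
Proof.
move=> schM cC cK.
have cyc X : circuit M X -> cyclic_flat M (mclosure X).
  by move=> cX; apply: cyclic_mclosure => e eX; exists X.
have [s|s] := schM _ _ (cyc _ cC) (cyc _ cK); [left|right];
  exact: subset_trans (sub_mclosure _) s.
Qed.

Lemma cyclic_closure A e : cyclic M A -> e \in A -> e \in mclosure (A :\ e).
Proof.
move=> cycA eA; have [C [cC eC sCA]] := cycA e eA.
by apply: (subsetP (mclosureS (setSD _ sCA))); apply: circuit_closure.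
Qed.

End MatroidTheory.

(** * Graphs *)

Section GraphRank.
Context (T : finType) (m : nat) (ends : T -> 'I_m * 'I_m).
Implicit Types (A B : {set T}) (e : T) (u v w : 'I_m).
Local Notation conn A := (connect (gadj ends A)).
Local Notation comp A v := [set w | conn A v w].

Lemma conn_sym A : connect_sym (gadj ends A).
Proof.
apply: sym_connect_sym => u v; rewrite /gadj.
by apply: eq_existsb => e; rewrite orbC.
Qed.

Lemma comp_eq A u v : (comp A u == comp A v) = conn A u v.
Proof.
apply/eqP/idP => [E|uv].
  by have := connect0 (gadj ends A) v; rewrite -[conn A v v]in_set -E inE.
by apply/setP=> w; rewrite !inE (same_connect (conn_sym A) uv).
Qed.

Lemma conn_edge A e : e \in A -> conn A (ends e).1 (ends e).2.
Proof.
move=> eA; apply: connect1; apply/existsP; exists e.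
by rewrite eA -surjective_pairing eqxx.
Qed.

Lemma connS A B : A \subset B -> subrel (conn A) (conn B).
Proof.
move=> sAB; apply: connect_sub => u v /existsP[e /andP[eA /orP[]/eqP E]];
  have := conn_edge (subsetP sAB e eA); rewrite E //.
by rewrite conn_sym.
Qed.

Lemma connU1 A e u v : conn (e |: A) u v ->
  [|| conn A u v, conn A u (ends e).1 && conn A (ends e).2 v
    | conn A u (ends e).2 && conn A (ends e).1 v].
Proof.
case/connectP=> p + ->; elim: p u => [|z p IH] u /=; first by rewrite connect0.
case/andP=> /existsP[f /andP[]]; rewrite in_setU1 => /orP[/eqP->|fA].
  by case/orP=> /eqP E /IH; rewrite E /= => /or3P[->|/andP[_ ->]|/andP[_ ->]];
    rewrite ?connect0 ?orbT.
move=> fE /IH.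
have uz : conn A u z by apply: connect1; apply/existsP; exists f; rewrite fA.
by rewrite !(same_connect (conn_sym A) uz).
Qed.

Lemma ncomp_le A : ncomp ends A <= m.
Proof. by apply: leq_trans (leq_imset_card _ _) _; rewrite card_ord. Qed.

Lemma ncompU1 A e :
  ncomp ends (e |: A) + ~~ conn A (ends e).1 (ends e).2 = ncomp ends A.
Proof.
set u := (ends e).1; set v := (ends e).2.
have uv' : conn (e |: A) u v by apply: conn_edge; rewrite setU11.
have sAeA := subsetUr [set e] A.
have [uv|nuv] := boolP (conn A u v).
  rewrite addn0; congr #|pred_of_set _|; apply: eq_imset => w; apply/setP=> z.
  rewrite !inE; apply/idP/idP => [/connU1|]; last exact: connS.
  case/or3P=> // /andP[]; rewrite -/u -/v => wu vz.
    exact: connect_trans wu (connect_trans uv vz).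
  by apply: connect_trans wu (connect_trans _ vz); rewrite conn_sym.
(* [phi] sends a component of [A] to the component of [e |: A] containing it. It is onto, and only
   the components of [u] and [v] are identified, so removing that of [v] makes it injective. *)
pose phi (S : {set 'I_m}) := [set z | [exists w in S, conn (e |: A) w z]].
have phiE w : phi (comp A w) = comp (e |: A) w.
  apply/setP=> z; rewrite !inE; apply/existsP/idP => [[y]|wz].
    by rewrite inE => /andP[/(connS sAeA)]; apply: connect_trans.
  by exists w; rewrite inE connect0.
pose I := [set comp A w | w : 'I_m].
have vI : comp A v \in I by apply: imset_f.
rewrite addn1 /ncomp -/I [RHS](cardsD1 (comp A v)) vI add1n; congr _.+1.
have -> : [set comp (e |: A) w | w : 'I_m] = phi @: (I :\ comp A v).
  apply/setP=> S; apply/imsetP/imsetP => [[w _ ->]|[S' + ->]].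
    have [E|neq] := eqVneq (comp A w) (comp A v); last first.
      by exists (comp A w); rewrite ?phiE // in_setD1 neq imset_f.
    exists (comp A u); rewrite ?phiE ?in_setD1 ?comp_eq ?nuv ?imset_f //.
    apply/eqP; rewrite comp_eq (conn_sym (e |: A)); apply: connect_trans uv' _.
    by apply: (connS sAeA); rewrite (conn_sym A) -comp_eq E.
  by rewrite in_setD1 => /andP[_ /imsetP[w _ ->]]; exists w; rewrite ?phiE.
apply/eqP/imset_injP => S1 S2 /setD1P[S1v /imsetP[w _ S1w]].
case/setD1P=> S2v /imsetP[z _ S2z]; rewrite {}S1w {}S2z in S1v S2v *.
move: S1v S2v.
rewrite !phiE !comp_eq => wv zv /eqP; rewrite comp_eq => wz; apply/eqP; rewrite comp_eq.
case/or3P: (connU1 wz) => // /andP[]; rewrite -/u -/v.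
  by move=> _; rewrite conn_sym (negPf zv).
by rewrite (negPf wv).
Qed.

Lemma graph_rankU1 A e : graph_rank ends (e |: A) =
  graph_rank ends A + ~~ conn A (ends e).1 (ends e).2.
Proof.
rewrite /graph_rank -(ncompU1 A e).
by have := ncomp_le A; rewrite -(ncompU1 A e); lia.
Qed.

Lemma graph_rank0 : graph_rank ends set0 = 0.
Proof.
rewrite /graph_rank /ncomp card_imset ?card_ord ?subnn // => u v /eqP.
rewrite comp_eq => /connectP[[|w p] //= /andP[/existsP[e]]].
by rewrite inE.
Qed.

(* The boundary modulo 2: a loop does not contribute. *)
Definition boundary A w : bool :=
  \big[addb/false]_(e in A) (((ends e).1 == w) (+) ((ends e).2 == w)).

(** [B] is the sum modulo 2 of the edges of a walk from [u] to [v]: an edge met again is removed. *)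
Lemma conn_boundary A u v : conn A u v ->
  exists2 B : {set T}, B \subset A & forall w, boundary B w = (u == w) (+) (v == w).
Proof.
case/connectP=> p + ->; elim: p u => [|z p IH] u /=.
  by exists set0; [rewrite sub0set|move=> w; rewrite /boundary big_set0 addbb].
case/andP=> /existsP[e /andP[eA eE]] /IH[B sBA bB].
have eE' w : ((ends e).1 == w) (+) ((ends e).2 == w) = (u == w) (+) (z == w).
  by case/orP: eE => /eqP-> //; rewrite addbC.
have [eB|eB] := boolP (e \in B).
  exists (B :\ e) => [|w]; first exact: subset_trans (subD1set _ _) sBA.
  move: (bB w); rewrite /boundary (big_setD1 e eB) /= eE'.
  by case: (u == w) (z == w) (last z p == w) (\big[_/_]_(_ in _) _) => [] [] [] [].
exists (e |: B) => [|w]; first by rewrite subUset sub1set eA.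
move: (bB w); rewrite /boundary (big_setU1 _ eB) /= eE' => ->.
by case: (u == w) (z == w) (last z p == w) => [] [] [].
Qed.

(** Summed over the component of [u], the boundary of [B] vanishes, because no edge of [B] leaves
    that component. So [v] must lie in it together with [u]. *)
Lemma boundary_conn A B u v : B \subset A ->
  (forall w, boundary B w = (u == w) (+) (v == w)) -> conn A u v.
Proof.
move=> sBA bB; pose W := comp A u.
have delta x : \big[addb/false]_(w in W) (x == w) = (x \in W).
  rewrite big_mkcond (bigD1 x) //= eqxx big1 ?addbF; first by case: (x \in W).
  by move=> y /negPf neq; rewrite eq_sym neq if_same.
have : \big[addb/false]_(w in W) boundary B w = false.
  rewrite exchange_big big1 //= => e /(subsetP sBA)/conn_edge eA.
  rewrite big_split /= !delta !inE.
  by rewrite (same_connect_r (conn_sym A) eA) addbb.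
rewrite (eq_bigr _ (fun w _ => bB w)) big_split /= !delta !inE connect0.
by case: (conn A u v).
Qed.

Lemma boundaryID A B w :
  boundary A w = boundary (A :&: B) w (+) boundary (A :\: B) w.
Proof. by rewrite /boundary (big_setID B). Qed.

End GraphRank.

(* The form in which the binarity of graphic matroids is used: e = sum of C1 over
   F_2, and C sums to 0, so e = sum of C \ C1 as well. *)
Lemma graphic_circuit_split (T : finType) (M : matroid T) (C : {set T}) (e : T) :
  graphic M -> circuit M C -> e \in mclosure M C ->
  exists C1 : {set T}, [/\ C1 \subset C, e \in mclosure M C1
                         & e \in mclosure M (C :\: C1)].
Proof.
case=> m [ends rE] cC eC.
have clE f A : (f \in mclosure M A) = connect (gadj ends A) (ends f).1 (ends f).2.
  rewrite inE !rE graph_rankU1 -[X in _ == X]addn0 eqn_add2l.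
  by case: (connect _ _ _).
have [E|[f fC]] := set_0Vmem C; first by have := circuit_rank cC; rewrite E cards0.
have := circuit_closure cC fC; rewrite clE => /conn_boundary[B sB bB].
have fB : f \notin B by apply: contraTN isT => /(subsetP sB); rewrite !inE eqxx.
(* [f |: B] is a dependent subset of [C], hence all of [C], and the boundaries of [f] and [B]
   cancel. *)
have bC w : boundary ends C w = false.
  rewrite -(_ : f |: B = C).
    rewrite /boundary big_setU1 //=; move: (bB w); rewrite /boundary => ->.
    by rewrite addbb.
  apply: (circuit_dep cC).
    by rewrite subUset sub1set fC (subset_trans sB) // subD1set.
  have /mclosureP-> : f \in mclosure M B by rewrite clE; apply: boundary_conn bB.
  by rewrite cardsU1 fB ltnS mrank_card.
move: eC; rewrite clE => /conn_boundary[C1 sC1 bC1].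
exists C1; split=> //; rewrite clE; first exact: boundary_conn bC1.
apply: (boundary_conn (subxx _)) => w.
have := boundaryID ends C C1 w; rewrite bC (setIidPr sC1) bC1.
by case: (_ (+) _) (boundary _ _ _) => [] [].
Qed.

(** * Graphic Schubert matroids *)

(* B is the set of coloops, P the thickened edge of the cycle, Q the set of its
   other edges; the remaining elements are loops.  P and Q are both empty when
   there is no cycle. *)
Record thick_cycle (T : finType) (M : matroid T) (B P Q : {set T}) : Prop := ThickCycle {
  thick_BP : [disjoint B & P];
  thick_BQ : [disjoint B & Q];
  thick_PQ : [disjoint P & Q];
  thick_eq0 : (P == set0) = (Q == set0);
  thick_rank : forall A : {set T},
    mrank M A = #|A :&: B| + minn (#|A :&: Q| + (A :&: P != set0)) #|Q|
}.

Section Classification.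
Context (T : finType) (M : matroid T).
Local Notation r := (mrank M).
Local Notation cl := (mclosure M).
Implicit Types (A B C D K X Y : {set T}) (e f c : T).

Let coloops := [set e | e \notin cl (~: [set e])].
Let core := [set e in cl (~: [set e]) | r [set e] != 0].

(** A coloop raises the rank of every set not containing it, and a loop lies in every closure;
    [core] is what remains without loops and coloops. *)
Lemma mrank_core A : r A = #|A :&: coloops| + r (A :&: core).
Proof.
have addB X D : X \subset coloops -> [disjoint X & D] -> r (X :|: D) = #|X| + r D.
  elim/set_ind_add: X => [|e X eX IH]; first by rewrite set0U cards0.
  rewrite subUset sub1set -!setI_eq0 setIUl setU_eq0 => /andP[eB sX] /andP[eD XD].
  rewrite setI_eq0 in XD; rewrite -setUA mrank_notin_closure ?IH ?cardsU1 ?eX //.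
  rewrite inE in eB; apply: contra eB; apply/subsetP/mclosureS.
  rewrite subsetC sub1set !inE negb_or eX /=.
  by rewrite setI_eq0 disjoints1 in eD.
rewrite -{1}(setID A coloops) addB ?subsetIr //; last first.
  by rewrite -setI_eq0 setDE setIACA setICr setI0.
congr (_ + _); rewrite -(@mrank_closureU _ _ (A :&: core) (A :\: coloops)).
  congr (mrank _ _); apply/esym/setUidPr/subsetP=> e.
  by rewrite !inE => /andP[-> /andP[->]].
apply/subsetP=> e; rewrite !inE negbK => /andP[ecl eA].
have [r0|rn0] := eqVneq (r [set e]) 0.
  have: e \in cl set0 by rewrite inE setU0 r0 mrank0.
  move/(subsetP (mclosureS M (sub0set (A :&: core)))).
  by rewrite inE.
by have := sub_mclosure M (A :&: core) => /subsetP/(_ e); rewrite !inE eA ecl rn0 => /(_ isT).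
Qed.

Lemma circuit_pair e c : circuit M [set e; c] -> e != c -> r [set c] != 0 ->
  e \in cl [set c] /\ r [set e; c] = 1.
Proof.
move=> cec ec rc; have := circuit_rank cec; rewrite cards2 ec => -[E]; split=> //.
apply/mclosureP; rewrite E; have := mrank_card M [set c]; rewrite cards1.
by move/eqP: rc; lia.
Qed.

(** The chord [e] closes two disjoint parts of [C] up to circuits [K1] and [K2]. One of them lies in
    the closure of the other, and a rank count then leaves it only one element besides [e]. *)
Lemma schubert_core_parallel C e :
  graphic M -> schubert M -> circuit M C ->
  e \notin C -> e \in cl C -> r [set e] != 0 ->
  exists2 c, c \in C & circuit M [set e; c].
Proof.
move=> gM sM cC eC eclC re0.
have [C1 [sC1 e1 e2]] := graphic_circuit_split gM cC eclC.
have eC1 : e \notin C1 by apply: contra eC; apply: (subsetP sC1).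
have eC2 : e \notin C :\: C1 by rewrite inE (negPf eC) andbF.
have [K1 [cK1 eK1 sK1]] := closure_circuit eC1 e1.
have [K2 [cK2 eK2 sK2]] := closure_circuit eC2 e2.
have sD X K : K \subset e |: X -> K :\ e \subset X.
  by move=> s; rewrite subDset.
have aux K L : circuit M K -> circuit M L -> e \in K -> e \in L ->
    K :\ e \subset C -> L :\ e \subset C -> [disjoint L :\ e & K :\ e] ->
    K \subset cl L -> exists2 c, c \in C & circuit M [set e; c].
  move=> cK cL eK eL sK sL dLK sKL.
  have sKL' : K :\ e \subset cl (L :\ e).
    apply: (subset_trans (subD1set _ _)); apply: (subset_trans sKL).
    apply: mclosure_sub; rewrite -{1}(setD1K eL) subUset sub1set.
    by rewrite (circuit_closure cL eL) sub_mclosure.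
  have rU := mrank_closureU sKL'.
  have rL := circuit_indep cL (properD1 eL).
  have cU : #|L :\ e :|: K :\ e| = #|L :\ e| + #|K :\ e|.
    by rewrite cardsU (_ : _ :&: _ = set0) ?cards0 ?subn0 //; apply/eqP; rewrite setI_eq0.
  have K0 : 0 < #|K :\ e|.
    rewrite lt0n cards_eq0; apply: contra re0 => /eqP K0.
    have := circuit_rank cK; rewrite -(setD1K eK) K0 setU0 cards1.
    by case=> ->.
  (* The union has rank [#|L :\ e|] and more elements than that, so it is a dependent subset of the
     circuit [C]. As the rank of [C] is one less than its size, [K :\ e] is a singleton. *)
  have EC : L :\ e :|: K :\ e = C.
    by apply: (circuit_dep cC); [rewrite subUset sL|rewrite rU rL cU -[X in X < _]addn0 ltn_add2l].
  move: (circuit_rank cC); rewrite -{1 2}EC rU cU rL -addn1 => /addnI/esym/eqP.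
  case/cards1P=> c Ec; exists c; first by rewrite (subsetP sK) // Ec set11.
  by rewrite -Ec setD1K.
have d12 : [disjoint K2 :\ e & K1 :\ e].
  apply: disjointWl (sD _ _ sK2) _; apply: disjointWr (sD _ _ sK1) _.
  by rewrite -setI_eq0 setDE -setIA [~: _ :&: _]setIC setICr setI0.
have s1 := subset_trans (sD _ _ sK1) sC1.
have s2 := subset_trans (sD _ _ sK2) (subsetDl _ _).
have [s|s] := schubert_circuits sM cK1 cK2; first exact: (aux K1 K2).
by apply: (aux K2 K1) => //; rewrite disjoint_sym.
Qed.

(** The decidable form, which allows a circuit of maximal rank to be chosen. *)
Lemma circuitP C : reflect (circuit M C)
  (dependent M C && [forall D : {set T}, (D \proper C) ==> ~~ dependent M D]).
Proof.
apply: (iffP andP) => -[dC minC]; split=> //.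
  by move=> D; apply/implyP/(forallP minC).
by apply/forallP=> D; apply/implyP/minC.
Qed.

(** [C] is a circuit of maximal rank. An element of [core] lies on some circuit [K]; if [K] is not
    inside the closure of [C], then [C] is inside that of [K], and maximality makes the two ranks
    equal. *)
Lemma schubert_core_circuit : schubert M -> core != set0 ->
  exists C, [/\ circuit M C, C \subset core & core \subset cl C].
Proof.
move=> sM /set0Pn[e0]; rewrite inE => /andP[e0cl re0].
have core_circuit e : e \in cl (~: [set e]) -> exists2 K, circuit M K & e \in K.
  move=> ecl; have [|K [cK eK _]] := closure_circuit _ ecl; last by exists K.
  by rewrite !inE eqxx.
have [K0 cK0 eK0] := core_circuit e0 e0cl.
pose isC C := dependent M C && [forall D : {set T}, (D \proper C) ==> ~~ dependent M D].
case: (@arg_maxnP _ K0 isC r (introT (circuitP K0) cK0)) => C /circuitP cC max.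
have {max} maxC K : circuit M K -> r K <= r C by move/circuitP/max.
have rC : 0 < r C.
  apply: leq_trans (maxC _ cK0).
  rewrite lt0n; apply: contra re0; rewrite -!leqn0; apply: leq_trans.
  by rewrite mrank_mono // sub1set.
(* A loop in [C] would be the whole circuit, which is excluded by the positive rank. *)
exists C; split=> //; apply/subsetP=> e.
  move=> eC; rewrite inE; apply/andP; split.
    apply: (subsetP (mclosureS _ _) _ (circuit_closure cC eC)).
    by rewrite subsetC sub1set !inE eqxx.
  apply: contraTneq rC => r0; rewrite -leqNgt.
  by rewrite -(_ : [set e] = C) ?r0 //; apply: (circuit_dep cC); rewrite ?sub1set ?cards1 ?r0.
rewrite inE => /andP[/core_circuit[K cK eK] _].
have [|/subsetP] := schubert_circuits sM cC cK; last exact.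
move/mrank_closureU => rKC; apply/mclosureP/eqP; rewrite eqn_leq andbC.
rewrite mrank_mono ?subsetUr //=; apply: leq_trans (maxC _ cK).
by rewrite -rKC mrank_mono // subUset sub1set inE eK subsetUr.
Qed.

Lemma graphic_schubert_thick_cycle : graphic M -> schubert M ->
  exists B P Q, thick_cycle M B P Q.
Proof.
move=> gM sM; have [core0|] := eqVneq core set0.
  exists coloops, set0, set0; split; rewrite -?setI_eq0 ?setI0 ?eqxx // => A.
  by rewrite mrank_core core0 !setI0 mrank0 cards0 minn0.
move/(schubert_core_circuit sM) => [C [cC sC Ccl]].
have nloop c : c \in core -> r [set c] != 0 by rewrite inE => /andP[].
have neqC e c : e \notin C -> c \in C -> e != c by move=> eC cC'; apply: contraNneq eC => ->.
have par e : e \in core -> e \notin C -> exists2 c, c \in C & circuit M [set e; c].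
  by move=> ecore eC; apply: schubert_core_parallel; rewrite ?(subsetP Ccl) ?nloop.
(* All elements of [core] outside [C] are parallel to one and the same [c]. If there are none, any
   element of [C] serves. *)
have [c cinC cpar] : exists2 c, c \in C & forall e, e \in core -> e \notin C -> e \in cl [set c].
  have [E|[e0]] := set_0Vmem (core :\: C).
    have [CE|[c cinC]] := set_0Vmem C.
      by have := circuit_rank cC; rewrite CE cards0.
    by exists c => // e e1 e2; have := in_setD core C e; rewrite E e1 e2 inE.
  rewrite inE => /andP[e0C e0core]; have [c0 c0C c0K] := par _ e0core e0C.
  have c0n := nloop _ (subsetP sC _ c0C).
  exists c0 => // e ecore eC; have [c cinC cK] := par _ ecore eC.
  have cn := nloop _ (subsetP sC _ cinC).
  have [ecl rec] := circuit_pair cK (neqC _ _ eC cinC) cn.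
  have [e0cl re0c0] := circuit_pair c0K (neqC _ _ e0C c0C) c0n.
  have r1 x : r [set x] != 0 -> r [set x] = 1.
    by have := mrank_card M [set x]; rewrite cards1; case: (r _) => [|[]].
  have [<-//|cc0] := eqVneq c c0.
  (* The circuits formed by [e], [c] and by [e0], [c0] have comparable closures of rank 1, which
     makes [c] and [c0] parallel. *)
  have rcc0 : r [set c; c0] = 1.
    apply/eqP; rewrite eqn_leq andbC -{1}(r1 _ cn) mrank_mono ?sub1set ?set21 //=.
    have [s|s] := schubert_circuits sM cK c0K.
      rewrite -re0c0 -[X in _ <= X]mrank_mclosure mrank_mono //.
      rewrite subUset !sub1set (subsetP s c) ?set22 //=.
      by rewrite (subsetP (sub_mclosure _ _)) // set22.
    rewrite -rec -[X in _ <= X]mrank_mclosure mrank_mono //.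
    rewrite subUset !sub1set (subsetP s c0) ?set22 // andbT.
    by rewrite (subsetP (sub_mclosure _ _)) // set22.
  have : r (e |: [set c; c0]) = 1.
    rewrite -rcc0; apply/mclosureP; apply: (subsetP (mclosureS _ _) _ ecl).
    by rewrite sub1set set21.
  move=> recc; apply/mclosureP; rewrite (r1 _ c0n); apply/eqP.
  rewrite eqn_leq -{1}recc -{1}(r1 _ c0n) !mrank_mono ?subsetUr //.
  by rewrite subUset !sub1set !inE !eqxx !orbT.
(* [P] consists of [c] and the elements of [core] outside [C], all of them parallel to [c]. *)
pose Q := C :\ c; pose P := core :\: Q.
have rC : r C = #|Q| by apply/eqP; rewrite -eqSS circuit_rank // (cardsD1 c) cinC.
have cP : c \in P by rewrite in_setD in_setD1 eqxx (subsetP sC).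
have Pcl e : e \in P -> e \in cl [set c].
  rewrite in_setD in_setD1 negb_and negbK => /andP[/orP[/eqP->|eC] ecore].
    by rewrite (subsetP (sub_mclosure _ _)) ?set11.
  exact: cpar.
have Qcore : Q \subset core by apply: subset_trans (subD1set _ _) sC.
have PQ : [disjoint P & Q] by rewrite -setI_eq0 /P setDE -setIA [~: _ :&: _]setIC setICr setI0.
have Bcore : [disjoint coloops & core].
  by rewrite disjoint_subset; apply/subsetP=> e; rewrite !inE => /negPf->.
exists coloops, P, Q; split=> //.
- exact: disjointWr (subsetDl _ _) Bcore.
- exact: disjointWr Qcore Bcore.
- rewrite (negPf (_ : P != set0)); last by apply/set0Pn; exists c.
  apply/esym/eqP => Q0; move: rC; rewrite Q0 cards0 => rC0.
  have := mrank_mono M (_ : [set c] \subset C); rewrite sub1set => /(_ cinC).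
  by rewrite rC0 leqn0 (negPf (nloop _ (subsetP sC _ cinC))).
move=> A; rewrite mrank_core; congr (_ + _).
have leQ : #|A :&: Q| <= #|Q| by rewrite subset_leq_card // subsetIr.
have sAQ : A :&: Q \subset C by apply: subset_trans (subsetIr _ _) (subD1set _ _).
have cAQ : c \notin A :&: Q by rewrite in_setI in_setD1 eqxx andbF.
have -> : A :&: core = A :&: Q :|: A :&: P.
  rewrite -setIUr; congr (_ :&: _).
  by rewrite /P setDE setUIr setUCr setIT (setUidPr Qcore).
have [E|/set0Pn[e]] := eqVneq (A :&: P) set0.
  rewrite E setU0 addn0 (minn_idPl leQ); apply: (circuit_indep cC).
  by apply/properP; split=> //; exists c.
rewrite in_setI => /andP[eA eP].
have ecore := subsetP (subsetDl _ _) e eP.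
have cle : c \in cl [set e].
  apply/mclosureP/eqP; rewrite setUC eqn_leq andbC mrank_mono ?subsetUl //=.
  have /mclosureP-> := Pcl e eP.
  have := mrank_card M [set c]; have := nloop _ ecore; rewrite cards1.
  by rewrite -lt0n => e0 c1; apply: leq_trans c1 e0.
(* Elements of [P] are interchangeable with [c]. The set [c |: (A :&: Q)] is [C] itself if [Q] lies
   in [A], and independent otherwise. *)
have -> : r (A :&: Q :|: A :&: P) = r (c |: (A :&: Q)).
  apply/eqP; rewrite eqn_leq; apply/andP; split.
    rewrite -[X in _ <= X](@mrank_closureU _ _ _ (A :&: P)).
      by rewrite mrank_mono // -setUA subsetUr.
    apply/subsetP=> f /setIP[_ /Pcl]; apply/subsetP/mclosureS.
    by rewrite sub1set setU11.
  rewrite -[X in _ <= X](@mrank_closureU _ _ _ [set c]).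
    by rewrite mrank_mono // setUC setSU // subsetUl.
  rewrite sub1set; apply: (subsetP (mclosureS _ _) _ cle).
  by rewrite sub1set in_setU !in_setI eA eP orbT.
have [sQA|nsQA] := boolP (Q \subset A).
  by rewrite (setIidPr sQA) /Q setD1K // rC -/Q (minn_idPr _) // leq_addr.
have lt : #|A :&: Q| < #|Q|.
  rewrite proper_card // properEneq subsetIr andbT.
  by apply: contraNneq nsQA => <-; rewrite subsetIl.
rewrite addn1 (minn_idPl lt) (circuit_indep cC) ?cardsU1 ?cAQ //.
rewrite properEcard subUset sub1set cinC sAQ cardsU1 cAQ.
by rewrite [X in _ < X](cardsD1 c) cinC -/Q add1n.
Qed.

End Classification.

(** * Closure and cyclic flats of a thick cycle *)

Section ThickCycle.
Context (T : finType) (M : matroid T) (B P Q : {set T}).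
Hypothesis sM : thick_cycle M B P Q.
Implicit Types (A F G : {set T}) (e : T).

Lemma thick_cycle_closure A e : e \notin A -> (e \in mclosure M A) =
  if e \in B then false
  else if e \in P then (A :&: P != set0) || (Q \subset A)
  else if e \in Q then (A :&: P != set0) && (Q :\ e \subset A)
  else true.
Proof.
move=> eA; rewrite inE !(thick_rank sM).
have cU (S : {set T}) : #|(e |: A) :&: S| = (e \in S) + #|A :&: S|.
  rewrite setIUl; have [eS|eS] := boolP (e \in S).
    rewrite (setIidPl _) ?sub1set // cardsU1; congr (nat_of_bool _ + _).
    by rewrite in_setI (negPf eA).
  by have /disjoint_setI0-> : [disjoint [set e] & S]; rewrite ?set0U ?disjoints1.
have nU : ((e |: A) :&: P != set0) = (e \in P) || (A :&: P != set0).
  by rewrite -!card_gt0 cU; case: (e \in P).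
have D (S1 S2 : {set T}) : [disjoint S1 & S2] -> ~~ ((e \in S1) && (e \in S2)).
  by move/disjoint_setI0/setP/(_ e); rewrite in_setI in_set0 => ->.
have sQ : (Q \subset A) = (#|A :&: Q| == #|Q|).
  apply/idP/eqP => [/setIidPr->//|c]; apply/setIidPr/eqP.
  by rewrite eqEcard subsetIr c /=.
have sQe : e \in Q -> (Q :\ e \subset A) = (#|A :&: Q|.+1 == #|Q|).
  move=> eQ; rewrite (cardsD1 e Q) eQ add1n eqSS.
  have -> : A :&: Q = A :&: (Q :\ e).
    apply/setP=> f; rewrite !inE; have [->|//] := eqVneq f e.
    by rewrite (negPf eA).
  apply/idP/eqP => [/setIidPr->//|c]; apply/setIidPr/eqP.
  by rewrite eqEcard subsetIr c /=.
have leQ : (e \in Q) + #|A :&: Q| <= #|Q| by rewrite -cU subset_leq_card // subsetIr.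
rewrite !cU nU; move: (D _ _ (thick_BP sM)) (D _ _ (thick_BQ sM)) (D _ _ (thick_PQ sM)) sQe leQ.
rewrite sQ; case: (e \in B) (e \in P) (e \in Q) => [] [] [] //= _ _ _ sQe leQ.
- by apply/negbTE; rewrite !add0n; lia.
- by move: leQ; case: (A :&: P != set0) => /=; rewrite ?add0n; lia.
- rewrite sQe //; move: leQ.
  by case: (A :&: P != set0) => /=; rewrite ?add0n; lia.
by rewrite !add0n eqxx.
Qed.

(** A cyclic flat avoids the coloops, contains the loops, contains [P] once it meets [P], and is
    [~: B] once it meets [Q]. The only candidates are thus the loops, the loops with [P], and
    [~: B], which form a chain. *)
Lemma thick_cycle_schubert : schubert M.
Proof.
have coloop_free F : cyclic_flat M F -> F \subset ~: B.
  case=> _ cycF; apply/subsetP=> e eF; rewrite inE.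
  have := cyclic_closure cycF eF; rewrite thick_cycle_closure ?setD11 //.
  by case: (e \in B).
have loops F e : cyclic_flat M F -> e \notin B -> e \notin P -> e \notin Q -> e \in F.
  case=> flF _ /negPf eB /negPf eP /negPf eQ; apply: contraT => eF.
  have := flF e eF; rewrite (mclosureP _ _ _ _) ?ltnn //.
  by rewrite thick_cycle_closure // eB eP eQ.
have fullP F e : cyclic_flat M F -> F :&: P != set0 -> e \in P -> e \in F.
  case=> flF _ FP eP; apply: contraT => eF.
  have := flF e eF; rewrite (mclosureP _ _ _ _) ?ltnn //.
  by rewrite thick_cycle_closure // FP eP (disjointFl (thick_BP sM) eP).
have fullQ F : cyclic_flat M F -> F :&: Q != set0 -> ~: B \subset F.
  move=> cF /set0Pn[e]; rewrite in_setI => /andP[eF eQ].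
  have := cyclic_closure cF.2 eF; rewrite thick_cycle_closure ?setD11 //.
  rewrite eQ (disjointFl (thick_BQ sM) eQ) (disjointFl (thick_PQ sM) eQ).
  case/andP=> FP sQF; apply/subsetP=> f; rewrite inE => fB.
  have [fP|fP] := boolP (f \in P).
    apply: fullP cF _ fP; apply: contra FP; rewrite -!subset0.
    by apply: subset_trans; rewrite setSI // subD1set.
  have [fQ|fQ] := boolP (f \in Q); last exact: loops.
  have [->//|fe] := eqVneq f e.
  by have := subsetP sQF f; rewrite !inE fe fQ => /(_ isT).
have small F G : cyclic_flat M F -> cyclic_flat M G -> F :&: Q = set0 ->
    (G :&: P != set0) || (F :&: P == set0) -> F \subset G.
  move=> cF cG FQ FP; apply/subsetP=> e eF.
  have eQ : e \notin Q by apply: contraTN isT => eQ; have := in_set0 e; rewrite -FQ inE eF eQ.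
  have eB : e \notin B by have := subsetP (coloop_free F cF) e eF; rewrite inE.
  have [eP|eP] := boolP (e \in P); last exact: loops.
  case/orP: FP => [GP|/eqP FP]; first exact: fullP cG GP eP.
  by have := in_set0 e; rewrite -FP inE eF eP.
move=> F G cF cG.
have [FQ|FQ] := eqVneq (F :&: Q) set0; last first.
  by right; apply: subset_trans (coloop_free G cG) (fullQ F cF FQ).
have [GQ|GQ] := eqVneq (G :&: Q) set0; last first.
  by left; apply: subset_trans (coloop_free F cF) (fullQ G cG GQ).
have [FP|FP] := boolP (F :&: P == set0); last by right; apply: small; rewrite ?FP.
by left; apply: small; rewrite ?FP ?orbT.
Qed.

End ThickCycle.

(** * Existence and isomorphism of thick cycles *)

Lemma thick_cycle_exists (T : finType) (B P Q : {set T}) :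
  [disjoint B & P] -> [disjoint B & Q] -> [disjoint P & Q] ->
  (P == set0) = (Q == set0) -> exists M : matroid T, thick_cycle M B P Q.
Proof.
move=> BP BQ PQ PQ0.
pose r (A : {set T}) := #|A :&: B| + minn (#|A :&: Q| + (A :&: P != set0)) #|Q|.
have cS (A A' S : {set T}) : A \subset A' -> #|A :&: S| <= #|A' :&: S|.
  by move=> sA; rewrite subset_leq_card // setSI.
have cUI (A A' S : {set T}) : #|(A :|: A') :&: S| + #|A :&: A' :&: S| = #|A :&: S| + #|A' :&: S|.
  by rewrite setIUl setIIl cardsUI.
have r_card A : r A <= #|A|.
  have h : #|A :&: B| + #|A :&: Q| + #|A :&: P| <= #|A|.
    rewrite -[X in _ <= X](cardsID B) -[#|A :\: B|](cardsID Q) addnA.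
    rewrite !leq_add // subset_leq_card //; apply/subsetP=> e; rewrite !inE;
      case/andP=> -> eS; first by rewrite eS (disjointFl BQ).
    by rewrite (disjointFl BP) // (disjointFr PQ).
  rewrite /r -card_gt0; apply: leq_trans h; rewrite -addnA leq_add2l.
  by apply: leq_trans (geq_minl _ _) _; rewrite leq_add2l; case: #|A :&: P|.
have r_mono (A A' : {set T}) : A \subset A' -> r A <= r A'.
  have arith b b' q q' p p' t : p <= p' -> q <= q' -> b <= b' ->
      b + minn (q + (0 < p)) t <= b' + minn (q' + (0 < p')) t by lia.
  by move=> sA; rewrite /r -!card_gt0; apply: arith; apply: cS.
have r_submod (A A' : {set T}) : r (A :|: A') + r (A :&: A') <= r A + r A'.
  (* The counts in [B], [P] and [Q] are modular, the indicator of meeting [P] is submodular, and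
     truncating a monotone submodular function keeps it submodular. *)
  have arith b1 b2 b3 b4 q1 q2 q3 q4 p1 p2 p3 p4 t :
      b1 + b2 = b3 + b4 -> q1 + q2 = q3 + q4 -> p1 + p2 = p3 + p4 ->
      q2 <= q3 -> q2 <= q4 -> p2 <= p3 -> p2 <= p4 ->
      b1 + minn (q1 + (0 < p1)) t + (b2 + minn (q2 + (0 < p2)) t)
      <= b3 + minn (q3 + (0 < p3)) t + (b4 + minn (q4 + (0 < p4)) t) by lia.
  by rewrite /r -!card_gt0; apply: arith; rewrite ?cUI ?cS ?subsetIl ?subsetIr.
by exists (Matroid r_card r_mono r_submod); split.
Qed.

Section ThickCycleCards.
Context (T : finType) (M : matroid T) (B P Q : {set T}).
Hypothesis sM : thick_cycle M B P Q.

Lemma thick_cycle_mat_rank : mat_rank M = #|B| + #|Q|.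
Proof.
by rewrite /mat_rank (thick_rank sM) !setTI (minn_idPr (leq_addr _ _)).
Qed.

Lemma thick_cycle_card :
  #|T| = #|B| + #|P| + #|Q| + #|~: (B :|: P :|: Q)|.
Proof.
rewrite -(cardsC (B :|: P :|: Q)) !cardsU setIUl.
rewrite (disjoint_setI0 (thick_BP sM)) (disjoint_setI0 (thick_BQ sM)).
by rewrite (disjoint_setI0 (thick_PQ sM)) setU0 cards0 !subn0.
Qed.

End ThickCycleCards.

(** The tuples recording the class of each index have equal multiplicities, so a permutation carries
    one to the other. *)
Lemma perm_of_classes n (B P Q B' P' Q' : {set 'I_n}) :
  [disjoint B & P] -> [disjoint B & Q] -> [disjoint P & Q] ->
  [disjoint B' & P'] -> [disjoint B' & Q'] -> [disjoint P' & Q'] ->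
  #|B| = #|B'| -> #|P| = #|P'| -> #|Q| = #|Q'| ->
  exists f : {perm 'I_n}, [/\ f @: B = B', f @: P = P' & f @: Q = Q'].
Proof.
move=> BP BQ PQ BP' BQ' PQ' cB cP cQ.
pose kind (X Y Z : {set 'I_n}) (e : 'I_n) := (e \in X, e \in Y, e \in Z).
pose t (X Y Z : {set 'I_n}) := [tuple kind X Y Z i | i < n].
have cnt X Y Z z : count_mem z (t X Y Z) = #|[set i | kind X Y Z i == z]|.
  rewrite /= -(map_tnth_enum (t X Y Z)) count_map cardE size_filter.
  by rewrite enumT; apply: eq_count => i /=; rewrite !inE tnth_mktuple.
have kcard (X Y Z : {set 'I_n}) : [disjoint X & Y] -> [disjoint X & Z] -> [disjoint Y & Z] ->
   forall z, count_mem z (t X Y Z) =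
   if z == (true, false, false) then #|X| else
   if z == (false, true, false) then #|Y| else
   if z == (false, false, true) then #|Z| else
   if z == (false, false, false) then n - (#|X| + #|Y| + #|Z|) else 0.
  move=> XY XZ YZ z; rewrite cnt.
  have nXY i : i \in X -> i \in Y -> False by move=> iX; rewrite (disjointFr XY).
  have nXZ i : i \in X -> i \in Z -> False by move=> iX; rewrite (disjointFr XZ).
  have nYZ i : i \in Y -> i \in Z -> False by move=> iX; rewrite (disjointFr YZ).
  have n3 : #|[set i | kind X Y Z i == (false, false, false)]| = n - (#|X| + #|Y| + #|Z|).
    have -> : [set i | kind X Y Z i == (false, false, false)] = ~: (X :|: Y :|: Z).
      by apply/setP=> i; rewrite !inE /kind; case: (i \in X) (i \in Y) (i \in Z) => [] [] [].
    rewrite cardsCs setCK card_ord !cardsU setIUl.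
    rewrite !(disjoint_setI0 XY) !(disjoint_setI0 XZ) !(disjoint_setI0 YZ).
    by rewrite setU0 cards0 !subn0.
  case: z => [[z1 z2] z3].
  case: z1; case: z2; case: z3 => //=; try (by rewrite n3);
    try (apply/eqP; rewrite cards_eq0; apply/eqP);
    try congr #|pred_of_set _|; apply/setP=> i; rewrite !inE /kind;
    move: (@nXY i) (@nXZ i) (@nYZ i);
    case: (i \in X) (i \in Y) (i \in Z) => [] [] [] //= h1 h2 h3;
    by [case: (h1 isT isT)|case: (h2 isT isT)|case: (h3 isT isT)].
have /tuple_permP[f /val_inj fE] : perm_eq (t B P Q) (t B' P' Q').
  by apply/allP => z _ /=; rewrite !kcard // cB cP cQ.
have kf i : kind B P Q i = kind B' P' Q' (f i).
  by have := congr1 (fun s => tnth s i) fE; rewrite !tnth_mktuple.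
by exists f; split; apply/setP=> i; rewrite -[i](permKV f) mem_imset ?permKV;
  try exact: perm_inj; case: (kf (f^-1%g i)); rewrite permKV.
Qed.

Lemma thick_cycle_iso n (M M' : matroid 'I_n) (B P Q B' P' Q' : {set 'I_n}) :
  thick_cycle M B P Q -> thick_cycle M' B' P' Q' ->
  #|B| = #|B'| -> #|P| = #|P'| -> #|Q| = #|Q'| -> mat_iso M M'.
Proof.
move=> sM sM' cB cP cQ.
have [f [fB fP fQ]] := perm_of_classes (thick_BP sM) (thick_BQ sM) (thick_PQ sM)
  (thick_BP sM') (thick_BQ sM') (thick_PQ sM') cB cP cQ.
exists f => A; rewrite (thick_rank sM) (thick_rank sM') -fB -fP -fQ.
rewrite -!imsetI; try (by move=> ? ? _ _; apply: perm_inj).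
by rewrite !card_imset; try exact: perm_inj; rewrite imset_eq0.
Qed.

(** * Realization of thick cycles by graphs *)

Lemma graph_cut (T : finType) m (ends : T -> 'I_m * 'I_m) (A : {set T})
    (W : pred 'I_m) u v :
  (forall e, e \in A -> W (ends e).1 = W (ends e).2) ->
  connect (gadj ends A) u v -> W u = W v.
Proof.
move=> cut uv; apply: (closed_connect _ uv) => x y /existsP[e /andP[/cut + /orP[]/eqP E]];
  by rewrite E.
Qed.

Definition ord_interval n a b : {set 'I_n} := [set e : 'I_n | a <= e < b].

Lemma card_ord_interval n a b : b <= n -> #|ord_interval n a b| = b - a.
Proof.
move=> le_bn; rewrite -sum1_card (eq_bigl (fun e : 'I_n => (a <= e) && (e < b))).
  rewrite -(big_mkord (fun i => (a <= i) && (i < b)) (fun _ => 1)).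
  rewrite -(big_nat_widen _ _ _ _ _ le_bn).
  transitivity (\sum_(a <= i < b) 1); last by rewrite sum_nat_const_nat muln1.
  by rewrite [RHS](big_nat_widenl _ 0).
by move=> e; rewrite inE.
Qed.

Section ThickCycleGraph.
Variables (n k s m : nat).
Hypotheses (le_sk : s <= k) (le_kmn : k + m <= n).
Implicit Types (A : {set 'I_n}) (e f : 'I_n).

(* The edges e < k form a path 0 - 1 - ... - k, whose first s edges are closed
   up to a cycle by m parallel edges between 0 and s; the other edges are loops. *)
Definition thick_cycle_ends e : 'I_k.+1 * 'I_k.+1 :=
  if e < k then (inord e, inord e.+1)
  else if e < k + m then (inord 0, inord s) else (ord0, ord0).

Local Notation ends := thick_cycle_ends.
Local Notation conn A := (connect (gadj ends A)).

Lemma ends_path e : e < k -> ends e = (inord e, inord e.+1).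
Proof. by rewrite /ends => ->. Qed.

Lemma ends_thick e : k <= e < k + m -> ends e = (inord 0, inord s).
Proof. by case/andP=> le_ke lt_e; rewrite /ends ltnNge le_ke lt_e. Qed.

Lemma conn_path A a b : a <= b <= k -> (forall e, a <= e < b -> e \in A) ->
  conn A (inord a) (inord b).
Proof.
elim: b => [|b IH] /andP[le_ab le_bk] sA.
  by rewrite (_ : a = 0) ?connect0 //; lia.
have [->|ne_ab] := eqVneq a b.+1; first exact: connect0.
have lt_bn : b < n by lia.
apply: (connect_trans (IH _ _)) => [|e le_e|]; [lia|apply: sA; lia|].
have := @conn_edge _ _ ends A (Ordinal lt_bn); rewrite ends_path //=.
by apply; apply: sA => /=; lia.
Qed.

(** This serves to refute connectedness: [W] is one side of a cut that no edge of [A] crosses. Loops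
    never cross it. *)
Lemma cut_path A (W : pred nat) a b : a <= k -> b <= k ->
  (forall e, e \in A -> e < k -> W e = W e.+1) ->
  (A :&: ord_interval n k (k + m) != set0 -> W 0 = W s) ->
  conn A (inord a) (inord b) -> W a = W b.
Proof.
move=> le_ak le_bk Wpath Wthick /(@graph_cut _ _ _ _ (fun v => W v)).
rewrite !inordK ?ltnS //; apply=> e eA; rewrite /ends.
have [lt_ek|le_ke] := ltnP e k; first by rewrite /= !inordK ?Wpath // ltnW.
case: ltnP => //= lt_e; rewrite !inordK //; apply: Wthick; apply/set0Pn; exists e.
by rewrite !inE eA le_ke.
Qed.

(** By adding edges one at a time, it suffices that an edge is spanned by [A] exactly when its ends
    are connected in [A]. Explicit paths and cuts decide each case. *)
Lemma thick_cycle_graphic (M : matroid 'I_n) :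
  thick_cycle M (ord_interval n s k) (ord_interval n k (k + m)) (ord_interval n 0 s) ->
  graphic M.
Proof.
move=> sM; exists k.+1, ends; elim/set_ind_add => [|e A eA IH].
  by rewrite mrank0 graph_rank0.
rewrite graph_rankU1 -IH.
suff <- : (e \in mclosure M A) = conn A (ends e).1 (ends e).2.
  have [/mclosureP->|/mrank_notin_closure->] := boolP (e \in mclosure M A).
    by rewrite addn0.
  by rewrite addn1.
have edgeP f : f \in A -> f <> e :> nat by move=> fA E; move: eA; rewrite -(val_inj E) fA.
rewrite (thick_cycle_closure sM) // !inE.
have [lt_ek|le_ke] := ltnP e k; last first.
  rewrite andbF /=; have [lt_e|le_e] := ltnP e (k + m); last first.
    by rewrite /ends !ltnNge le_ke le_e /= connect0 (leq_trans le_sk).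
  rewrite ends_thick ?le_ke //=.
  have [AP|AP] := boolP (A :&: _ != set0).
    have [f] := set0Pn _ AP; rewrite in_setI inE => /andP[fA fP].
    by have := @conn_edge _ _ ends A f; rewrite ends_thick // => /(_ fA).
  have [sQA|nsQA] /= := boolP (_ \subset A).
    apply/esym/conn_path => //= f lt_fs; apply: (subsetP sQA).
    by rewrite inE.
  (* No thick edge is present and the path edge [j] is missing, so the cut after [j] separates 0
     from [s]. *)
  apply/esym/negP => /(@cut_path A) cut.
  have [j] := subsetPn nsQA; rewrite inE /= => lt_js jA.
  have := cut (fun v => v <= j) (leq0n k) le_sk; rewrite leq0n leqNgt lt_js.
  move=> h; have // : true = false; apply: h => [f fA lt_fk|]; last by rewrite (negPf AP).
  have : f <> j :> nat by move=> E; move: jA; rewrite -(val_inj E) fA.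
  by lia.
rewrite ends_path //= andbT.
have [le_se|lt_es] := leqP s e.
  (* The edge [e] is a bridge: 0 and [s] lie on the same side of the cut after [e]. *)
  apply/esym/negP => /(@cut_path A (fun v => v <= e)) cut.
  have : (e <= e) = (e < e); last by rewrite leqnn ltnn.
  apply: cut => //; first exact: ltnW.
  by move=> f fA _; have := edgeP f fA; lia.
rewrite /=.
have [AP|AP] := boolP (A :&: _ != set0); last first.
  apply/esym/negP => /(@cut_path A (fun v => v <= e)) cut.
  have : (e <= e) = (e < e); last by rewrite leqnn ltnn.
  apply: cut => //; rewrite ?(negPf AP) //; first exact: ltnW.
  by move=> f fA _; have := edgeP f fA; lia.
have [sQA|nsQA] /= := boolP (_ \subset A).
  have sQ f : f < s -> f <> e :> nat -> f \in A.
    move=> lt_fs fe; apply: (subsetP sQA); rewrite in_setD1 inE /= lt_fs andbT.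
    by apply/eqP=> E; rewrite E in fe.
  (* The ends of [e] are joined the other way round the cycle: back to 0, over a thick edge to [s],
     and back to [e.+1]. *)
  have c0e : conn A (inord 0) (inord e).
    by apply: conn_path => [|f]; [lia|move=> lt_fe; apply: sQ; lia].
  have ces : conn A (inord e.+1) (inord s).
    by apply: conn_path => [|f]; [lia|move=> lt_fe; apply: sQ; lia].
  have c0s : conn A (inord 0) (inord s).
    have [f] := set0Pn _ AP; rewrite in_setI inE => /andP[fA fP].
    by have := @conn_edge _ _ ends A f; rewrite ends_thick // => /(_ fA).
  rewrite (conn_sym ends A) in c0e; rewrite (conn_sym ends A) in ces.
  by rewrite (connect_trans c0e (connect_trans c0s ces)).
have [j] := subsetPn nsQA; rewrite !inE /= => /andP[je lt_js] jA.
have {je} je : j <> e :> nat by move/val_inj/eqP; rewrite (negPf je).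
have nj f : f \in A -> f <> j :> nat by move=> fA E; move: jA; rewrite -(val_inj E) fA.
(* Both [e] and [j] are missing from the cycle; the cut is the arc of vertices between them. *)
apply/esym/negP => /(@cut_path A (fun v => (v <= j) (+) (v <= e))) cut.
have : (e <= j) (+) (e <= e) = (e < j) (+) (e < e).
  apply: cut => //; first exact: ltnW.
    by move=> f fA _; have := edgeP f fA; have := nj f fA; lia.
  by move=> _; lia.
by lia.
Qed.

End ThickCycleGraph.

(** * Tutte polynomials *)

Local Open Scope ring_scope.

Lemma tutte_iso (T : finType) (M M' : matroid T) : mat_iso M M' -> tutte M = tutte M'.
Proof.
case=> f fE; have finj := @perm_inj _ f.
have imfK (A : {set T}) : f @: (f @^-1: A) = A.
  by apply/setP=> i; rewrite -[i](permKV f) (mem_imset _ _ finj) inE.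
rewrite /tutte [RHS](reindex (fun A : {set T} => f @: A)) /=; last first.
  apply: onW_bij; exists (fun A : {set T} => f @^-1: A) => // A.
  by apply/setP=> i; rewrite inE (mem_imset _ _ finj).
have fT : f @: [set: T] = [set: T] by rewrite -[RHS]imfK preimsetT.
by apply: eq_bigr => A _; rewrite fE -{2}fT fE card_imset.
Qed.

Section TutteShape.
Context (R : comNzRingType) (T : finType).
Implicit Types (A B P Q L S : {set T}).

Lemma prod_exp_mem (c : R) S : \prod_(e : T) c ^+ (e \in S) = c ^+ #|S|.
Proof.
rewrite -prodr_const [RHS]big_mkcond; apply: eq_bigr => e _.
by case: (e \in S).
Qed.

(** The product over the elements of [F e + G e] is expanded: [A] collects the elements for which
    [F e] is chosen. *)
Lemma sum_subsets_classes B P Q L (b b' p p' q q' l l' : R) :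
  (forall e, (e \in B) + (e \in P) + (e \in Q) + (e \in L) = 1)%N ->
  \sum_(A : {set T})
    (b ^+ #|A :&: B| * b' ^+ #|B :\: A| * (p ^+ #|A :&: P| * p' ^+ #|P :\: A|)
     * (q ^+ #|A :&: Q| * q' ^+ #|Q :\: A|) * (l ^+ #|A :&: L| * l' ^+ #|L :\: A|))
  = (b + b') ^+ #|B| * (p + p') ^+ #|P| * (q + q') ^+ #|Q| * (l + l') ^+ #|L|.
Proof.
move=> cover; rewrite -!prod_exp_mem -!big_split /=.
pose F e := b ^+ (e \in B) * p ^+ (e \in P) * q ^+ (e \in Q) * l ^+ (e \in L).
pose G e := b' ^+ (e \in B) * p' ^+ (e \in P) * q' ^+ (e \in Q) * l' ^+ (e \in L).
rewrite (eq_bigr (fun e => F e + G e)) => [|e _]; last first.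
  rewrite /F /G; have := cover e.
  by case: (e \in B) (e \in P) (e \in Q) (e \in L) => [] [] [] [] //= _;
    rewrite !expr0 !expr1 ?mulr1 ?mul1r.
rewrite bigA_distr /=; apply: eq_bigr => A _.
rewrite -!prod_exp_mem -!big_split /=; apply: eq_bigr => e _.
rewrite /F /G !inE.
by case: (e \in A) => /=; rewrite ?andbT ?andbF ?expr0 ?mulr1 ?mul1r.
Qed.

(* The rank would be additive over the classes but for the indicators of
   A :&: P != set0 and Q \subset A; after multiplication by X Y every summand is
   a combination of five functions that are products over the elements. *)
Lemma tutte_sum_thick_cycle (X Y : R) (M : matroid T) B P Q : thick_cycle M B P Q ->
  X * Y * \sum_(A : {set T}) X ^+ (mrank M setT - mrank M A) * Y ^+ (#|A| - mrank M A)
  = (X + 1) ^+ #|B| * (Y + 1) ^+ #|~: (B :|: P :|: Q)| *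
    (X * Y * (X + 1) ^+ #|Q| + (X + 1) ^+ #|Q| * ((Y + 1) ^+ #|P| - 1)
     + (X * Y - 1) * ((Y + 1) ^+ #|P| - 1)).
Proof.
move=> sM; pose L := ~: (B :|: P :|: Q); rewrite -/L.
have cover e : ((e \in B) + (e \in P) + (e \in Q) + (e \in L) = 1)%N.
  have D S1 S2 : [disjoint S1 & S2] -> ~~ ((e \in S1) && (e \in S2)).
    by move/disjoint_setI0/setP/(_ e); rewrite in_setI in_set0 => ->.
  move: (D _ _ (thick_BP sM)) (D _ _ (thick_BQ sM)) (D _ _ (thick_PQ sM)).
  by rewrite !inE; case: (e \in B) (e \in P) (e \in Q) => [] [] [].
have sumE b b' p p' q q' l l' := esym (sum_subsets_classes b b' p p' q q' l l' cover).
(* A factor [0 + 1] for [P] keeps only the sets disjoint from [P], and [1 + 0] for [Q] only those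
   containing [Q]. *)
have -> : (X + 1) ^+ #|B| * (Y + 1) ^+ #|L| *
    (X * Y * (X + 1) ^+ #|Q| + (X + 1) ^+ #|Q| * ((Y + 1) ^+ #|P| - 1)
     + (X * Y - 1) * ((Y + 1) ^+ #|P| - 1)) =
   X * Y * ((1 + X) ^+ #|B| * (0 + 1) ^+ #|P| * (1 + X) ^+ #|Q| * (Y + 1) ^+ #|L|)
   + ((1 + X) ^+ #|B| * (Y + 1) ^+ #|P| * (1 + X) ^+ #|Q| * (Y + 1) ^+ #|L|)
   - ((1 + X) ^+ #|B| * (0 + 1) ^+ #|P| * (1 + X) ^+ #|Q| * (Y + 1) ^+ #|L|)
   + (X * Y - 1) * ((1 + X) ^+ #|B| * (Y + 1) ^+ #|P| * (1 + 0) ^+ #|Q| * (Y + 1) ^+ #|L|)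
   - (X * Y - 1) * ((1 + X) ^+ #|B| * (0 + 1) ^+ #|P| * (1 + 0) ^+ #|Q| * (Y + 1) ^+ #|L|).
  rewrite add0r addr0 !expr1n ![1 + X]addrC; ring.
rewrite !sumE !mulr_sumr -!sumrN -!big_split /=; apply: eq_bigr => A _.
rewrite !(thick_rank sM) !setTI.
have cA : #|A| = (#|A :&: B| + #|A :&: P| + #|A :&: Q| + #|A :&: L|)%N.
  have cI S : #|A :&: S| = (\sum_(e in A) (e \in S))%N.
    by rewrite -sum1_card (eq_bigl _ _ (fun e => in_setI e A S)) big_mkcondr.
  rewrite !cI -!big_split /= -sum1_card.
  by apply: eq_bigr => e _; rewrite cover.
have c S : #|S| = (#|A :&: S| + #|S :\: A|)%N by rewrite -[LHS](cardsID A S) setIC.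
have p0 : (A :&: P != set0) = (0 < #|A :&: P|)%N by rewrite card_gt0.
rewrite cA (c B) (c Q) p0 !expr1n.
move: #|A :&: B| #|B :\: A| #|A :&: Q| #|Q :\: A| #|A :&: P| #|A :&: L| => b b' q q' p l.
rewrite (minn_idPr (leq_addr _ _)).
case: p => [|p] /=.
  rewrite addn0 (minn_idPl (leq_addr _ _)) !expr0 !mulr1 ?mul1r.
  have -> : (b + b' + (q + q') - (b + q) = b' + q')%N by lia.
  have -> : (b + 0 + q + l - (b + q) = l)%N by lia.
  rewrite exprD; case: q' => [|q']; rewrite ?expr0 ?expr1n; ring.
rewrite [0 ^+ p.+1]expr0n /=.
case: q' => [|q'].
  rewrite addn0 (minn_idPr (leq_addr _ _)).
  have -> : (b + b' + q - (b + q) = b')%N by lia.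
  have -> : (b + p.+1 + q + l - (b + q) = p.+1 + l)%N by lia.
  by rewrite exprD !expr0 ; ring.
have -> : minn (q + 1) (q + q'.+1) = (q + 1)%N by lia.
have -> : (b + b' + (q + q'.+1) - (b + (q + 1)) = b' + q')%N by lia.
have -> : (b + p.+1 + q + l - (b + (q + 1)) = p + l)%N by lia.
by rewrite [0 ^+ q'.+1]expr0n !exprD !exprS /=; ring.
Qed.

End TutteShape.

(** Here [k] is the rank, [d] the nullity, [i] the number of loops and [a] that of coloops. *)
Definition tutte_gen (d k i a : nat) : {poly {poly int}} :=
  'X ^+ k * 'X%:P ^+ d - ('X * 'X%:P - 'X - 'X%:P)
    * ((\sum_(i <= j < d) 'X%:P ^+ j) * (\sum_(a <= b < k) 'X ^+ b)).

Lemma mulr_geom_nat (R : comNzRingType) (x : R) i d : (i <= d)%N ->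
  (x - 1) * (\sum_(i <= j < d) x ^+ j) = x ^+ d - x ^+ i.
Proof.
move=> le_id; rewrite mulr_sumr -(telescope_sumr (fun j => x ^+ j) le_id).
by apply: eq_bigr => j _; rewrite mulrBl mul1r exprS.
Qed.

(** Multiplying by the nonzero [X * Y] turns both geometric sums into differences of powers. *)
Lemma tutte_thick_cycle (T : finType) (M : matroid T) (B P Q : {set T}) :
  thick_cycle M B P Q ->
  tutte M = tutte_gen (#|T| - mat_rank M) (mat_rank M) #|~: (B :|: P :|: Q)| #|B|.
Proof.
move=> sM; pose X : {poly {poly int}} := 'X - 1; pose Y : {poly {poly int}} := ('X - 1)%:P.
have YE : Y = 'X%:P - 1 by rewrite /Y polyCB.
have XY0 : X * Y != 0 by rewrite mulf_neq0 // ?polyC_eq0 polyXsubC_eq0.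
apply: (mulfI XY0); rewrite [LHS](tutte_sum_thick_cycle X Y sM).
rewrite (thick_cycle_card sM) (thick_cycle_mat_rank sM).
have -> : (#|B| + #|P| + #|Q| + #|~: (B :|: P :|: Q)| - (#|B| + #|Q|)
           = #|~: (B :|: P :|: Q)| + #|P|)%N.
  by move: #|B| #|P| #|Q| #|~: _|; lia.
move: #|B| #|P| #|Q| #|~: _| => a p q i; rewrite /tutte_gen.
have := mulr_geom_nat ('X : {poly {poly int}}) (leq_addr q a).
have := mulr_geom_nat ('X%:P : {poly {poly int}}) (leq_addr p i).
rewrite -YE -/X; set u := \sum_(_ <= _ < _) _; set v := \sum_(_ <= _ < _) _ => Yu Xv.
rewrite [RHS]mulrBr; have -> : X * Y * (('X * 'X%:P - 'X - 'X%:P) * (u * v))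
   = ('X * 'X%:P - 'X - 'X%:P) * ((Y * u) * (X * v)) by ring.
rewrite Yu Xv YE /X !subrK !exprD; ring.
Qed.

(** * Tutte polynomials lie in the span of those of thick cycles *)

Section TutteSpan.
Variables (n k : nat) (S : {poly {poly int}} -> Prop).
Hypothesis le_kn : (k <= n)%N.
Let d := (n - k)%N.
(** A set closed under differences stands for the integer span. *)
Hypothesis SB : forall f g, S f -> S g -> S (f - g).
Hypothesis Sgen : forall i a,
  (i < d)%N && (a < k)%N || (i == d) && (a == k) -> S (tutte_gen d k i a).

Local Notation x := ('X : {poly {poly int}}).
Local Notation y := ('X%:P : {poly {poly int}}).
Local Notation D := (x * y - x - y).

Let S_top : S (x ^+ k * y ^+ d).
Proof.
have -> : x ^+ k * y ^+ d = tutte_gen d k d k.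
  by rewrite /tutte_gen !big_geq // !mulr0 subr0.
by apply: Sgen; rewrite !eqxx orbT.
Qed.

Let S0 : S 0. Proof. by rewrite -(subrr (x ^+ k * y ^+ d)); apply: SB. Qed.
Let SD f g : S f -> S g -> S (f + g).
Proof. by move=> Sf Sg; rewrite -[g]opprK -[- g]sub0r; apply/SB/SB. Qed.

(** On the border [i = d] or [a = k] a sum is empty and only x^k y^d remains. Those with just one
    equality come from no thick cycle, but the differences in [S_monomial] need them. *)
Let S_gen i a : (i <= d)%N -> (a <= k)%N -> S (tutte_gen d k i a).
Proof.
move=> le_id le_ak.
have [lt_id|ge_id] := ltnP i d; last first.
  by rewrite /tutte_gen (big_geq ge_id) mul0r mulr0 subr0; exact: S_top.
have [lt_ak|ge_ak] := ltnP a k; last first.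
  by rewrite /tutte_gen (big_geq ge_ak) !mulr0 subr0; exact: S_top.
by apply: Sgen; rewrite lt_id lt_ak.
Qed.

(** The mixed second difference in [i] and [a] cancels x^k y^d and isolates one monomial. *)
Let S_monomial i a : (i < d)%N -> (a < k)%N -> S (D * (y ^+ i * x ^+ a)).
Proof.
move=> lt_id lt_ak.
have -> : D * (y ^+ i * x ^+ a) =
    (tutte_gen d k i.+1 a - tutte_gen d k i a)
    - (tutte_gen d k i.+1 a.+1 - tutte_gen d k i a.+1).
  rewrite /tutte_gen (big_ltn lt_id) (big_ltn lt_ak).
  set u := \sum_(_ <= _ < _) _; set v := \sum_(_ <= _ < _) _; ring.
by apply: (SB (SB _ _) (SB _ _)); apply: S_gen => //; apply: ltnW.
Qed.

(** Factors x and y are traded for x - 1 and y - 1 one at a time, within the same degree bounds. *)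
Let S_shifted i j a b : (i + j < d)%N -> (a + b < k)%N ->
  S (D * (y ^+ i * (y - 1) ^+ j * (x ^+ a * (x - 1) ^+ b))).
Proof.
elim: j i => [|j IH] i lt_d.
  elim: b a => [|b IHb] a lt_k.
    by rewrite !expr0 !mulr1; apply: S_monomial; lia.
  have -> : D * (y ^+ i * (y - 1) ^+ 0 * (x ^+ a * (x - 1) ^+ b.+1)) =
      D * (y ^+ i * (y - 1) ^+ 0 * (x ^+ a.+1 * (x - 1) ^+ b))
      - D * (y ^+ i * (y - 1) ^+ 0 * (x ^+ a * (x - 1) ^+ b)).
    by rewrite !exprS expr0; ring.
  by apply: SB; apply: IHb; lia.
move=> lt_k.
have -> : D * (y ^+ i * (y - 1) ^+ j.+1 * (x ^+ a * (x - 1) ^+ b)) =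
    D * (y ^+ i.+1 * (y - 1) ^+ j * (x ^+ a * (x - 1) ^+ b))
    - D * (y ^+ i * (y - 1) ^+ j * (x ^+ a * (x - 1) ^+ b)).
  by rewrite !exprS; ring.
by apply: SB; apply: IH; lia.
Qed.

(** As (x - 1)(y - 1) - 1 = D, each diagonal step adds D times a monomial in x - 1 and y - 1. *)
Let S_diagonal a b t : (a + t <= k)%N -> (b + t <= d)%N ->
  S ((x - 1) ^+ (a + t) * (y - 1) ^+ (b + t) - (x - 1) ^+ a * (y - 1) ^+ b).
Proof.
elim: t => [|t IH] le_k le_d; first by rewrite !addn0 subrr.
have -> : (x - 1) ^+ (a + t.+1) * (y - 1) ^+ (b + t.+1) - (x - 1) ^+ a * (y - 1) ^+ b
  = D * (y ^+ 0 * (y - 1) ^+ (b + t) * (x ^+ 0 * (x - 1) ^+ (a + t)))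
    + ((x - 1) ^+ (a + t) * (y - 1) ^+ (b + t) - (x - 1) ^+ a * (y - 1) ^+ b).
  by rewrite !addnS !exprS !expr0; ring.
by apply: SD; [apply: S_shifted; lia|apply: IH; lia].
Qed.

Let rank_bounds (M : matroid 'I_n) (A : {set 'I_n}) : mat_rank M = k ->
  [/\ (mrank M A <= k)%N, (mrank M A <= #|A|)%N & (#|A| + k <= n + mrank M A)%N].
Proof.
move=> rM; have := mrank_submod M A (~: A); rewrite setUCr setICr mrank0 addn0.
have := mrank_mono M (subsetT A); have := mrank_card M A.
have := mrank_card M (~: A); have := cardsC A; rewrite card_ord.
move: rM; rewrite /mat_rank => ->.
by move: (mrank M A) (mrank M (~: A)) #|A| #|~: A| => *; split; lia.
Qed.

(** [M] is compared with the matroid [M0] of k coloops and n - k loops. For each [A] the two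
    summands differ by a diagonal shift, whose length is the difference of the two ranks of [A]. *)
Lemma tutte_in_span (M : matroid 'I_n) : mat_rank M = k -> S (tutte M).
Proof.
move=> rM.
have [||||M0 sM0] := @thick_cycle_exists _ (ord_interval n 0 k) set0 set0.
- by rewrite -setI_eq0 setI0.
- by rewrite -setI_eq0 setI0.
- by rewrite -setI_eq0 setI0.
- by rewrite eqxx.
have cB : #|ord_interval n 0 k| = k by rewrite card_ord_interval ?subn0.
have rM0 : mat_rank M0 = k by rewrite (thick_cycle_mat_rank sM0) cards0 addn0.
have SM0 : S (tutte M0).
  rewrite (tutte_thick_cycle sM0) rM0 card_ord cB !setU0 cardsCs setCK card_ord cB.
  exact: S_gen.
rewrite -[tutte M](subrK (tutte M0)); apply: SD => //.
rewrite /tutte -sumrB; apply: (big_ind S) => // A _.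
have [r1 r2 r3] := rank_bounds A rM; have [s1 s2 s3] := rank_bounds A rM0.
rewrite -/(mat_rank M) -/(mat_rank M0) rM rM0 polyCB.
move: r1 r2 r3 s1 s2 s3; move: (mrank M A) (mrank M0 A) #|A| => r s c r1 r2 r3 s1 s2 s3.
have [le_rs|/ltnW le_sr] := leqP r s.
  have -> : (k - r = k - s + (s - r))%N by lia.
  have -> : (c - r = c - s + (s - r))%N by lia.
  by apply: S_diagonal; rewrite /d; lia.
rewrite -opprB -sub0r; apply: SB => //.
have -> : (k - s = k - r + (r - s))%N by lia.
have -> : (c - s = c - r + (r - s))%N by lia.
by apply: S_diagonal; rewrite /d; lia.
Qed.

End TutteSpan.

(** * Linear independence *)

Lemma coef_geom_nat (R : nzRingType) a k b :
  (\sum_(a <= c < k) 'X^c : {poly R})`_b = ((a <= b) && (b < k))%N%:R.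
Proof.
rewrite coef_sum (eq_bigr (fun c => if c == b then 1 else 0)) => [|c _].
  by rewrite -big_mkcond big_nat1_eq; case: ifP.
by rewrite coefXn eq_sym; case: eqP.
Qed.

(* At x = y = 2 the factor xy - x - y vanishes, which gives the sum of the
   coefficients; dividing by it then gives their cumulative sums. *)
Lemma tutte_gen_free (d k : nat) (I : finType) (l a : I -> nat) (e : I -> int) :
  (forall i, ((l i < d) && (a i < k) || (l i == d) && (a i == k))%N) ->
  (forall i j, l i = l j -> a i = a j -> i = j) ->
  \sum_i (e i)%:~R * tutte_gen d k (l i) (a i) = 0 -> forall i, e i = 0.
Proof.
move=> box inj sum0.
pose y : {poly {poly int}} := 'X%:P; pose D := 'X * y - 'X - y.
pose u i : {poly int} := \sum_(l i <= j < d) 'X^j.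
pose v i : {poly {poly int}} := \sum_(a i <= b < k) 'X^b.
have sumE : \sum_i (e i)%:~R * tutte_gen d k (l i) (a i) =
    (\sum_i e i)%:~R * ('X^k * y ^+ d) - D * \sum_i (u i)%:P * v i *~ e i.
  rewrite raddf_sum mulr_suml mulr_sumr -sumrB; apply: eq_bigr => i _.
  have -> : (u i)%:P = \sum_(l i <= j < d) y ^+ j.
    by rewrite rmorph_sum; apply: eq_bigr => j _; rewrite rmorphXn.
  by rewrite /tutte_gen -/y -/D -/(v i) -mulrzl; ring.
have total : \sum_i e i = 0.
  pose ev : {rmorphism {poly {poly int}} -> int} :=
    horner_eval (2 : int) \o horner_eval (2%:P : {poly int}).
  have evX : ev 'X = 2 by rewrite /= /horner_eval hornerX hornerC.
  have evy : ev y = 2 by rewrite /= /horner_eval hornerC hornerX.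
  have evD : ev D = 0 by rewrite /D !rmorphB rmorphM evX evy.
  move: (congr1 ev sum0); rewrite sumE rmorph0 rmorphB !rmorphM evD mul0r subr0.
  rewrite rmorph_int !rmorphXn evX evy intz => /eqP.
  by rewrite !mulf_eq0 !expf_eq0 !andbF !orbF => /eqP.
have D0 : D != 0.
  apply/eqP => /(congr1 (fun p : {poly {poly int}} => p`_0)).
  rewrite !coefB coefXM coefX coefC coef0 /= !(subr0, sub0r) => /eqP.
  by rewrite oppr_eq0 polyX_eq0.
have W0 : \sum_i (u i)%:P * v i *~ e i = 0.
  apply: (mulfI D0); rewrite mulr0; apply/eqP; rewrite -oppr_eq0; apply/eqP.
  by move: sum0; rewrite sumE total mul0r sub0r.
(* This sum is the coefficient of x^b y^j in the quotient by [D]. *)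
have cum j b : (j < d)%N -> (b < k)%N ->
    \sum_(i | (l i <= j)%N && (a i <= b)%N) e i = 0.
  move=> lt_jd lt_bk; have := congr1 (fun p : {poly {poly int}} => p`_b`_j) W0.
  rewrite !coef_sum !coef0 => W0jb; rewrite -[RHS]W0jb big_mkcond; apply: eq_bigr => i _.
  rewrite !coefMrz coefCM coef_geom_nat lt_bk mulr_natr coefMn coef_geom_nat lt_jd.
  by rewrite !andbT; case: (l i <= j)%N (a i <= b)%N => [] [] /=; rewrite ?mul0rz ?intz.
(* At the exceptional point (d, k) the cumulative sum is the total. *)
have cum' i : \sum_(i' | (l i' <= l i)%N && (a i' <= a i)%N) e i' = 0.
  have /orP[/andP[li ai]|/andP[/eqP li /eqP ai]] := box i; first exact: cum.
  rewrite -[RHS]total; apply: eq_bigl => i'; rewrite li ai.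
  by have := box i'; lia.
(* Every other index in the quadrant below [i] has a smaller [l + a], so its coefficient vanishes by
   induction. *)
move=> i; have [m] := ubnP (l i + a i)%N; elim: m i => // m IH i lt_m.
rewrite -(cum' i) (bigD1 i) ?leqnn //= big1 ?addr0 // => i' /andP[/andP[le_l le_a] ne].
apply: IH; have [El|] := eqVneq (l i') (l i); last by lia.
have [Ea|] := eqVneq (a i') (a i); last by lia.
by rewrite (inj _ _ El Ea) eqxx in ne.
Qed.

Theorem theoremE (n k s : nat) (N : 'I_s -> matroid 'I_n) :
  (k <= n)%N ->
  (forall i, [/\ graphic (N i), schubert (N i) & mat_rank (N i) = k]) ->
  (forall i j, mat_iso (N i) (N j) -> i = j) ->
  (forall M : matroid 'I_n, graphic M -> schubert M -> mat_rank M = k ->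
     exists i, mat_iso M (N i)) ->
  forall M : matroid 'I_n, mat_rank M = k ->
    exists! c : {ffun 'I_s -> int},
      tutte M = \sum_(i < s) (c i)%:~R * tutte (N i).
Proof.
move=> le_kn hN injN surjN M rM; set d := (n - k)%N.
have /fin_all_exists[t tN] : forall i, exists t : {set 'I_n} * {set 'I_n} * {set 'I_n},
    thick_cycle (N i) t.1.1 t.1.2 t.2.
  move=> i; have [gN sN _] := hN i.
  by have [B [P [Q sBPQ]]] := graphic_schubert_thick_cycle gN sN; exists (B, P, Q).
pose l i := #|~: ((t i).1.1 :|: (t i).1.2 :|: (t i).2)|.
pose a i := #|(t i).1.1|.
have rank_t i : k = (a i + #|(t i).2|)%N.
  by have [_ _ <-] := hN i; rewrite (thick_cycle_mat_rank (tN i)).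
have card_t i : n = (a i + #|(t i).1.2| + #|(t i).2| + l i)%N.
  by rewrite -(thick_cycle_card (tN i)) card_ord.
have tutteN i : tutte (N i) = tutte_gen d k (l i) (a i).
  by have [_ _ rN] := hN i; rewrite (tutte_thick_cycle (tN i)) rN card_ord.
(* The second alternative is the case without a cycle: [P] and [Q] are empty together. *)
have box i : ((l i < d) && (a i < k) || (l i == d) && (a i == k))%N.
  have := thick_eq0 (tN i); rewrite -!cards_eq0; have := rank_t i; have := card_t i.
  rewrite /d; move: (l i) (a i) #|(t i).1.2| #|(t i).2| => li ai p q; lia.
have inj i j : l i = l j -> a i = a j -> i = j.
  move=> El Ea; apply: injN.
  have cQ : #|(t i).2| = #|(t j).2| by have := rank_t i; have := rank_t j; lia.
  have cP : #|(t i).1.2| = #|(t j).1.2|.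
    by have := card_t i; have := card_t j; lia.
  exact: thick_cycle_iso (tN i) (tN j) Ea cP cQ.
pose S f := exists c : {ffun 'I_s -> int}, f = \sum_(i < s) (c i)%:~R * tutte (N i).
have SB f g : S f -> S g -> S (f - g).
  move=> [c ->] [c' ->]; exists [ffun i => c i - c' i]; rewrite -sumrB.
  by apply: eq_bigr => i _; rewrite ffunE rmorphB mulrBl.
have Sgen i0 a0 : (i0 < d)%N && (a0 < k)%N || (i0 == d) && (a0 == k) ->
    S (tutte_gen d k i0 a0).
  move=> box0.
  have le_kmn : (k + (d - i0) <= n)%N by rewrite /d; lia.
  have le_sk : (k - a0 <= k)%N by apply: leq_subr.
  have disj x1 x2 y1 y2 : (x2 <= y1)%N || (y2 <= x1)%N ->
      [disjoint ord_interval n x1 x2 & ord_interval n y1 y2].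
    by move=> xy; rewrite disjoint_subset; apply/subsetP=> e; rewrite !inE; lia.
  (* The sizes are chosen to give [a0] coloops and, by counting, [i0] loops; the intervals fit
     [thick_cycle_ends]. *)
  have [||||M0 sM0] := @thick_cycle_exists _ (ord_interval n (k - a0) k)
     (ord_interval n k (k + (d - i0))) (ord_interval n 0 (k - a0)).
  - by apply: disj; rewrite leqnn.
  - by apply: disj; rewrite leqnn orbT.
  - by apply: disj; rewrite le_sk orbT.
  - rewrite -!cards_eq0 !card_ord_interval //; last by lia.
    by move: box0; rewrite /d; lia.
  have cB : #|ord_interval n (k - a0) k| = a0 by rewrite card_ord_interval //; lia.
  have cP : #|ord_interval n k (k + (d - i0))| = (d - i0)%N.
    by rewrite card_ord_interval // addKn.
  have cQ : #|ord_interval n 0 (k - a0)| = (k - a0)%N.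
    by rewrite card_ord_interval ?subn0 //; lia.
  have rM0 : mat_rank M0 = k.
    by rewrite (thick_cycle_mat_rank sM0) cB cQ; lia.
  have cL := thick_cycle_card sM0; rewrite card_ord cB cP cQ in cL.
  have [j isoj] := surjN M0 (thick_cycle_graphic le_sk le_kmn sM0) (thick_cycle_schubert sM0) rM0.
  exists [ffun i => (i == j)%:R].
  rewrite (bigD1 j) //= big1 => [|i ne_ij]; last by rewrite ffunE (negPf ne_ij) mul0r.
  rewrite ffunE eqxx mul1r addr0 -(tutte_iso isoj) (tutte_thick_cycle sM0) rM0 card_ord cB.
  by congr tutte_gen; move: cL box0; move: #|~: _|; rewrite /d; lia.
have [c cE] := tutte_in_span le_kn SB Sgen rM.
exists c; split=> // c' c'E; apply/ffunP=> i; apply/eqP; rewrite -subr_eq0; apply/eqP.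
apply: (tutte_gen_free (e := fun i => c i - c' i) box inj).
rewrite -[RHS](subrr (tutte M)) {1}cE c'E -sumrB.
by apply: eq_bigr => j _; rewrite rmorphB mulrBl tutteN.
Qed.
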